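(* Let $A\in\mathbb{R}^{m\times n}$, $b\in\mathbb{R}^m$, $c\in\mathbb{R}^n$, let $e$ denote an all-ones vector, and consider the binary linear problem $$\text{(O)}\qquad \min\ c^Tx\quad\text{s.t.}\quad Ax\le b,\ x\in\{0,1\}^n,$$ and the lifted problem in the $2n$ variables $(x,\bar x)$ $$\text{(L)}\qquad \min\ \tfrac12\left(c^Tx-c^T\bar x+c^Te\right)\quad\text{s.t.}\quad Ax-A\bar x\le 2b-Ae,\ \ x+\bar x=e,\ \ x,\bar x\in\{0,1\}^n.$$ Then there is a one-to-one correspondence between the (regular) permutation symmetries of problem (L) and the complement symmetries of problem (O).
   Context: In problem (L), $\bar x$ is merely the name of a second block of $n$ variables. Permutation symmetry: a symmetry of a problem given by an objective vector, a coefficient matrix and a right-hand side is a permutation $\pi^{c}$ of its columns (variables) together with a permutation $\pi^{r}$ of its rows (constraints) such that the permuted problem is identical to the original one. That is, if the problem has coefficient matrix $M$, right-hand side $d$ and objective vector $f$, then $M_{i,j}=M_{\pi^{r}(i),\pi^{c}(j)}$, $d_i=d_{\pi^{r}(i)}$ and $f_j=f_{\pi^{c}(j)}$ for all $i,j$, and inequality rows are mapped to inequality rows and equality rows to equality rows. When one speaks of the symmetries of a problem, the row permutation is dropped: a permutation symmetry is a column permutation $\pi^{c}$ for which a suitable row permutation $\pi^{r}$ exists. For (L), the coefficient matrix is $\begin{pmatrix}A&-A\\ I&I\end{pmatrix}$, where the first $m$ rows are inequalities and the last $n$ rows are equalities. The right-hand side is $\begin{pmatrix}2b-Ae\\ e\end{pmatrix}$,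 and the objective vector is $\frac12\begin{pmatrix}c\\-c\end{pmatrix}$ (the additive constant in the objective plays no role). Signed permutation matrix: a square matrix with exactly one nonzero entry in each row and in each column, each nonzero entry being $+1$ or $-1$. Complement symmetry (also called signed symmetry or complement-based symmetry) of (O): a pair $(Q,q)$, where $Q$ is an $n\times n$ signed permutation matrix and $q\in\mathbb{R}^n$, such that: (i) $c^Tx=c^T(Qx+q)$ for all $x\in\mathbb{R}^n$; (ii) there is an $m\times m$ (ordinary) permutation matrix $P$ such that $b-Ax=P\left(b-A(Qx+q)\right)$ for all $x\in\mathbb{R}^n$; (iii) for all $x\in\mathbb{R}^n$, $Qx+q\in\{0,1\}^n$ if and only if $x\in\{0,1\}^n$. Conditions (i) and (ii) are equivalent to $Q^Tc=c$, $q^Tc=0$, $PAQ=A$, $P(b-Aq)=b$ for some permutation matrix $P$. *)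

(* Defs.v *)
From HB Require Import structures.
From mathcomp Require Import all_boot all_order all_fingroup all_algebra.
From mathcomp Require Import all_classical all_reals.

Set Implicit Arguments.
Unset Strict Implicit.
Unset Printing Implicit Defensive.

Import GRing.Theory Num.Theory.

Local Open Scope ring_scope.
Local Open Scope classical_set_scope.

(** Data of the problem [min obj^T x] over binary [x] such that, for every row
    [i], [(coef x)_i = rhs_i] if [is_eq i] and [(coef x)_i <= rhs_i] otherwise.
    All variables are binary, and an additive constant in the objective is
    irrelevant to symmetries, so neither is recorded. *)
Record bin_problem (R : realType) (p k : nat) := BinProblem {
  obj : 'cV[R]_k;
  coef : 'M[R]_(p, k);
  rhs : 'cV[R]_p;
  is_eq : pred 'I_p
}.

Definition perm_symmetry (R : realType) (p k : nat) (L : bin_problem R p k)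
    (pc : 'S_k) : Prop :=
  exists pr : 'S_p,
    [/\ forall i j, coef L i j = coef L (pr i) (pc j),
        forall i, rhs L i 0 = rhs L (pr i) 0,
        forall j, obj L j 0 = obj L (pc j) 0
      & forall i, is_eq L i = is_eq L (pr i)].

Definition ones (R : realType) (n : nat) : 'cV[R]_n := const_mx 1.

(** The column index [lshift n j] is [x_j]; [rshift n j] is its copy, which the
    equality rows (the last [n]) force to be [1 - x_j]. *)
Definition lifted (R : realType) (m n : nat) (A : 'M[R]_(m, n))
    (b : 'cV[R]_m) (c : 'cV[R]_n) : bin_problem R (m + n) (n + n) :=
  {| obj := 2^-1 *: col_mx c (- c);
     coef := block_mx A (- A) 1%:M 1%:M;
     rhs := col_mx (2 *: b - A *m ones R n) (ones R n);
     is_eq := [pred i : 'I_(m + n) | (m <= i)%N] |}.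

Definition signed_perm_mx (R : realType) (n : nat) (Q : 'M[R]_n) : Prop :=
  [/\ forall i, exists! j, Q i j != 0,
      forall j, exists! i, Q i j != 0
    & forall i j, Q i j != 0 -> Q i j = 1 \/ Q i j = -1].

Definition binary (R : realType) (n : nat) (x : 'cV[R]_n) : Prop :=
  forall i, x i 0 = 0 \/ x i 0 = 1.

Definition complement_symmetry (R : realType) (m n : nat) (A : 'M[R]_(m, n))
    (b : 'cV[R]_m) (c : 'cV[R]_n) (s : 'M[R]_n * 'cV[R]_n) : Prop :=
  let: (Q, q) := s in
  [/\ signed_perm_mx Q,
      forall x : 'cV[R]_n, c^T *m x = c^T *m (Q *m x + q),
      exists2 P : 'M[R]_m, is_perm_mx P
        & forall x : 'cV[R]_n, b - A *m x = P *m (b - A *m (Q *m x + q))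
    & forall x : 'cV[R]_n, binary (Q *m x + q) <-> binary x].

(* Main.v *)
Require Import Defs.
From HB Require Import structures.
From mathcomp Require Import all_boot all_order all_fingroup all_algebra.
From mathcomp Require Import all_classical all_reals.
From mathcomp Require Import lra.

(** Both kinds of symmetry are encoded by the same data: a permutation [sigma]
    of the [n] variables of (O) together with a sign [s j] for each of them,
    telling whether [x_j] becomes [x_(sigma j)] or [1 - x_(sigma j)].

    On the side of (L), the equality rows [x_j + xbar_j = 1] must be permuted
    among themselves.  Hence a symmetry permutes the pairs [{x_j, xbar_j}]:
    it moves the pair [j] to the pair [sigma j] and either keeps or exchanges
    its two members according to [s j] ([perm_symmetry_pairs]).  For such a
    permutation the equality rows impose nothing more, and as the columns of
    [xbar] are the opposites of those of [x], what remains is a condition on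
    the signed permutation matrix [Q] of [(sigma, s)]:
    [c^T Q = c^T], and some row permutation carries [A Q] to [A] while fixing
    [2 b - A e] ([perm_symmetry_signed]).

    On the side of (O), preservation of the binary points forces the
    translation: since [x_j] ranges over [{0, 1}], row [sigma j] of [q] is [0]
    when the sign is [+1] and [1] when it is [-1], that is,
    [q = (e - Q e) / 2] ([binary_signed]).  Substituting this value of [q] in
    the invariance of objective and constraints gives exactly the same
    condition on [Q] ([complement_symmetryP]).  The identity behind it is
    [2 (b - A q) = (2 b - A e) + A Q e].

    The bijection therefore sends a column permutation to the pair [(Q, q)]
    read off from its action on the first [n] columns. *)

Set Implicit Arguments.
Unset Strict Implicit.
Unset Printing Implicit Defensive.

Import GRing.Theory Num.Theory.

Local Open Scope ring_scope.
Local Open Scope classical_set_scope.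

(** * Columns of the lifted problem as signed indices *)

Section SignedIndices.
Variable n : nat.
Implicit Types (k : 'I_(n + n)) (j : 'I_n) (t : bool).

(** The flag [t] is the exponent of the sign: as the block [-A] shows, the copy
    of a variable stands for its opposite. *)
Definition signed_index t j : 'I_(n + n) :=
  if t then rshift n j else lshift n j.

Definition index_of k : 'I_n := match fintype.split k with inl j => j | inr j => j end.

Definition is_copy k : bool := if fintype.split k is inr _ then true else false.

Lemma index_of_signed t j : index_of (signed_index t j) = j.
Proof.
rewrite /index_of /signed_index; case: t.
  by rewrite -[rshift n j]/(unsplit (inr j)) unsplitK.
by rewrite -[lshift n j]/(unsplit (inl j)) unsplitK.
Qed.

Lemma is_copy_signed t j : is_copy (signed_index t j) = t.
Proof.
rewrite /is_copy /signed_index; case: t.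
  by rewrite -[rshift n j]/(unsplit (inr j)) unsplitK.
by rewrite -[lshift n j]/(unsplit (inl j)) unsplitK.
Qed.

Lemma signed_indexK k : signed_index (is_copy k) (index_of k) = k.
Proof. by rewrite /is_copy /index_of; case: split_ordP => j ->. Qed.

Definition signed_perm_fun (sigma : 'S_n) (s : 'I_n -> bool) k : 'I_(n + n) :=
  signed_index (is_copy k (+) s (index_of k)) (sigma (index_of k)).

Lemma signed_perm_fun_inj sigma s : injective (signed_perm_fun sigma s).
Proof.
move=> k l ekl; rewrite -[k]signed_indexK -[l]signed_indexK.
have ei : index_of k = index_of l.
  move/(congr1 index_of): ekl; rewrite !index_of_signed; exact: perm_inj.
move/(congr1 is_copy): ekl; rewrite !is_copy_signed ei => /addIb ->.
by [].
Qed.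

Definition signed_perm (sigma : 'S_n) (s : 'I_n -> bool) : 'S_(n + n) :=
  perm (@signed_perm_fun_inj sigma s).

Lemma signed_permE sigma s t j :
  signed_perm sigma s (signed_index t j) = signed_index (t (+) s j) (sigma j).
Proof. by rewrite permE /signed_perm_fun is_copy_signed index_of_signed. Qed.

(** A permutation of the [2n] columns which respects the partition into pairs
    acts on each pair by an element of a group of order two, which the sign
    [s] records.  Injectivity is what forces the two members of a pair to have
    distinct images, hence the image of the copy from that of the original. *)
Lemma pair_preserving_signed (pc : 'S_(n + n)) :
  (forall k l, index_of k = index_of l -> index_of (pc k) = index_of (pc l)) ->
  exists sigma s, pc = signed_perm sigma s.
Proof.
move=> pcP.
pose f j := index_of (pc (signed_index false j)).
pose s j := is_copy (pc (signed_index false j)).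
have pcE t j : pc (signed_index t j) = signed_index (t (+) s j) (f j).
  have ef : index_of (pc (signed_index t j)) = f j.
    by apply: pcP; rewrite !index_of_signed.
  rewrite -[LHS]signed_indexK ef; congr signed_index.
  case: t ef => [ef|_]; last by rewrite /s.
  have : is_copy (pc (signed_index true j)) != s j.
    apply/eqP => es.
    have : pc (signed_index true j) = pc (signed_index false j).
      by rewrite -[LHS]signed_indexK ef es signed_indexK.
    by move/perm_inj/(congr1 is_copy); rewrite !is_copy_signed.
  by case: is_copy; case: (s j).
have f_inj : injective f.
  move=> j l ejl.
  have : pc (signed_index (s j) j) = pc (signed_index (s l) l).
    by rewrite !pcE !addbb ejl.
  by move/perm_inj/(congr1 index_of); rewrite !index_of_signed.
exists (perm f_inj), s; apply/permP => k.
by rewrite -[k]signed_indexK signed_permE pcE permE.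
Qed.

End SignedIndices.

(** * Signed permutation matrices *)

Section SignedMatrices.
Variables (R : realType) (n : nat).

(** Only the first [n] columns are used: on a permutation that respects pairs
    the action on the copies is then determined. *)
Definition signed_mx (pc : 'S_(n + n)) : 'M[R]_n :=
  \matrix_(i, j) ((-1) ^+ is_copy (pc (signed_index false j))
                  *+ (i == index_of (pc (signed_index false j)))).

Lemma signed_mxE sigma s i j :
  signed_mx (signed_perm sigma s) i j = (-1) ^+ s j *+ (i == sigma j).
Proof. by rewrite mxE signed_permE is_copy_signed index_of_signed. Qed.

Lemma signed_mx_neq0 sigma s i j :
  (signed_mx (signed_perm sigma s) i j != 0) = (i == sigma j).
Proof.
by rewrite signed_mxE mulrb; case: ifP => _; rewrite ?signr_eq0 ?eqxx.
Qed.

Lemma signed_mx_signed_perm sigma s :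
  signed_perm_mx (signed_mx (signed_perm sigma s)).
Proof.
split=> [i|j|i j].
- exists (sigma^-1%g i); split=> [|j]; first by rewrite signed_mx_neq0 permKV.
  by rewrite signed_mx_neq0 => /eqP ->; rewrite permK.
- exists (sigma j); split=> [|i]; first by rewrite signed_mx_neq0.
  by rewrite signed_mx_neq0 => /eqP.
- rewrite signed_mx_neq0 signed_mxE => ->; rewrite mulr1n.
  by case: (s j); [right|left].
Qed.

Lemma signed_perm_mxP (Q : 'M[R]_n) :
  signed_perm_mx Q -> exists sigma s, Q = signed_mx (signed_perm sigma s).
Proof.
move=> [rowQ colQ entQ].
pose f j := projT1 (cid (colQ j)).
have fP j : Q (f j) j != 0 by rewrite /f; case: cid => i [].
have f_uniq i j : Q i j != 0 -> i = f j.
  by rewrite /f; case: cid => i' /= [_ u] /u ->.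
have f_inj : injective f.
  move=> j l ejl; have [k [_ u]] := rowQ (f j).
  by rewrite -(u _ (fP j)) -(u l) // ejl.
exists (perm f_inj), (fun j => Q (f j) j == -1); apply/matrixP => i j.
rewrite signed_mxE permE; case: (i =P f j) => [->|ne]; last first.
  by rewrite mulr0n; apply: contra_notP ne => /eqP; exact: f_uniq.
rewrite mulr1n; case: eqP => [-> //|neN1].
by have [|/neN1] := entQ _ _ (fP j).
Qed.

Lemma signed_mx_inj sigma s sigma' s' :
  signed_mx (signed_perm sigma s) = signed_mx (signed_perm sigma' s') ->
  signed_perm sigma s = signed_perm sigma' s'.
Proof.
move/matrixP => eQ.
have esigma j : sigma j = sigma' j.
  by apply/eqP; rewrite -(signed_mx_neq0 sigma' s') -eQ signed_mx_neq0.
apply/permP => k; rewrite -[k]signed_indexK !signed_permE esigma.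
have := eQ (sigma (index_of k)) (index_of k).
by rewrite !signed_mxE esigma eqxx !mulr1n => /signr_inj ->.
Qed.

Lemma mul_mx_signed p (M : 'M[R]_(p, n)) sigma s i j :
  (M *m signed_mx (signed_perm sigma s)) i j = (-1) ^+ s j * M i (sigma j).
Proof.
rewrite mxE (bigD1 (sigma j)) //= big1 ?addr0.
  by rewrite signed_mxE eqxx mulr1n mulrC.
by move=> k /negPf nk; rewrite signed_mxE nk mulr0n mulr0.
Qed.

Lemma mul_signed_mx p (M : 'M[R]_(n, p)) sigma s j l :
  (signed_mx (signed_perm sigma s) *m M) (sigma j) l = (-1) ^+ s j * M j l.
Proof.
rewrite mxE (bigD1 j) //= big1 ?addr0 ?signed_mxE ?eqxx ?mulr1n //.
by move=> k nk; rewrite signed_mxE (inj_eq perm_inj) eq_sym (negPf nk) mul0r.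
Qed.

(** ** The translation attached to a signed permutation matrix *)

Definition offset (Q : 'M[R]_n) : 'cV[R]_n := 2^-1 *: (ones R n - Q *m ones R n).

Lemma offset_signed sigma s j :
  offset (signed_mx (signed_perm sigma s)) (sigma j) 0 = (s j)%:R.
Proof.
rewrite 2!mxE [X in _ + X]mxE mul_signed_mx !mxE.
by case: (s j); rewrite ?expr1 ?expr0 /=; lra.
Qed.

(** The points [0] and [e] alone determine [q]: they give, in each row, two
    values [q_i] and [q_i +- 1] that must both lie in [{0, 1}]. *)
Lemma binary_signed sigma s (q : 'cV[R]_n) :
  (forall x, binary (signed_mx (signed_perm sigma s) *m x + q) <-> binary x) <->
  q = offset (signed_mx (signed_perm sigma s)).
Proof.
set Q := signed_mx _.
have rowE x j : (Q *m x + q) (sigma j) 0 = (-1) ^+ s j * x j 0 + q (sigma j) 0.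
  by rewrite mxE mul_signed_mx.
split=> [binQ|-> x].
  have b0 : binary (Q *m 0 + q) by apply/binQ => i; rewrite mxE; left.
  have b1 : binary (Q *m ones R n + q) by apply/binQ => i; rewrite mxE; right.
  apply/colP => i; rewrite -[i](permKV sigma) offset_signed.
  set j := (sigma^-1)%g i; have := b0 (sigma j); have := b1 (sigma j).
  rewrite !rowE !mxE; case: (s j) => /=; rewrite ?expr1 ?expr0; lra.
have binE j : (((-1) ^+ s j * x j 0 + (s j)%:R = 0) \/
               ((-1) ^+ s j * x j 0 + (s j)%:R = 1)) <-> (x j 0 = 0 \/ x j 0 = 1).
  by case: (s j) => /=; rewrite ?expr1 ?expr0; split; lra.
have rowE' j : (Q *m x + offset Q) (sigma j) 0 = (-1) ^+ s j * x j 0 + (s j)%:R.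
  by rewrite mxE mul_signed_mx offset_signed.
split=> bx i; first by apply/binE; rewrite -rowE'.
by rewrite -[i](permKV sigma) rowE'; apply/binE.
Qed.

End SignedMatrices.

(** * The two kinds of symmetry *)

Definition sum_perm_fun p q (pr : 'S_p) (pr' : 'S_q) (i : 'I_(p + q)) :=
  unsplit (match fintype.split i with inl i => inl (pr i) | inr i => inr (pr' i) end).

Lemma sum_perm_fun_inj p q pr pr' : injective (@sum_perm_fun p q pr pr').
Proof.
move=> i j /(can_inj unsplitK).
by case: (split_ordP i) => i' ->; case: (split_ordP j) => j' -> // [] /perm_inj ->.
Qed.

Section Symmetries.
Variables (R : realType) (m n : nat).
Variables (A : 'M[R]_(m, n)) (b : 'cV[R]_m) (c : 'cV[R]_n).

Definition lifted_rhs : 'cV[R]_m := 2 *: b - A *m ones R n.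

(** The common meeting point of both kinds of symmetry: with [y = x - xbar],
    problem (L) asks to minimize [c^T y] subject to [A y <= 2 b - A e], and
    [Q] is a linear symmetry of that problem. *)
Definition linear_symmetry (Q : 'M[R]_n) : Prop :=
  c^T = c^T *m Q /\
  exists pr : 'S_m,
    A = row_perm pr (A *m Q) /\ lifted_rhs = row_perm pr lifted_rhs.

Lemma coef_lifted_ineq i t j :
  coef (lifted A b c) (lshift n i) (signed_index t j) = (-1) ^+ t * A i j.
Proof.
case: t => /=; first by rewrite block_mxEur mxE expr1 mulN1r.
by rewrite block_mxEul mul1r.
Qed.

Lemma coef_lifted_eq i t j :
  coef (lifted A b c) (rshift m i) (signed_index t j) = (i == j)%:R.
Proof. by case: t => /=; rewrite ?block_mxEdl ?block_mxEdr mxE. Qed.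

Lemma obj_lifted t j :
  obj (lifted A b c) (signed_index t j) 0 = 2^-1 * ((-1) ^+ t * c j 0).
Proof.
case: t => /=; rewrite mxE ?col_mxEd ?col_mxEu ?mxE ?expr1 ?mulN1r //.
by rewrite expr0 mul1r.
Qed.

Lemma is_eq_lifted_ineq i : is_eq (lifted A b c) (lshift n i) = false.
Proof. by rewrite /= leqNgt ltn_ord. Qed.

Lemma is_eq_lifted_eq i : is_eq (lifted A b c) (rshift m i) = true.
Proof. by rewrite /= leq_addr. Qed.

(** Row [j] of [x + xbar = e] has its nonzero coefficients exactly in the
    columns of pair [j], and it can only be sent to another such row. *)
Lemma perm_symmetry_pairs pc :
  perm_symmetry (lifted A b c) pc -> exists sigma s, pc = signed_perm sigma s.
Proof.
move=> [pr [coefP _ _ kindP]]; apply: pair_preserving_signed => k l ekl.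
have := kindP (rshift m (index_of k)); rewrite is_eq_lifted_eq.
case: (split_ordP (pr (rshift m (index_of k)))) => i ei; rewrite ei.
  by rewrite is_eq_lifted_ineq.
have row_k k' : index_of k' = index_of k -> index_of (pc k') = i.
  move=> ek; have := coefP (rshift m (index_of k)) k'.
  rewrite -{1}[k']signed_indexK -[pc k']signed_indexK ei !coef_lifted_eq ek.
  rewrite eqxx index_of_signed; case: eqP => // _ /eqP.
  by rewrite oner_eq0.
by move=> _; rewrite !row_k.
Qed.

(** Inequality rows can only be permuted among themselves, which yields the row
    permutation of [A].  Conversely such a permutation extends to all rows of
    (L) by letting [sigma] act on the equality rows: row [j] is the row of pair
    [j], so it has to follow that pair. *)
Lemma perm_symmetry_signed sigma s :
  perm_symmetry (lifted A b c) (signed_perm sigma s) <->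
  linear_symmetry (signed_mx R (signed_perm sigma s)).
Proof.
split=> [[pr [coefP rhsP objP kindP]]|[cQ [pr [AQ dP]]]].
  split.
    apply/rowP => j; rewrite mul_mx_signed !mxE.
    have := objP (signed_index false j); rewrite signed_permE !obj_lifted.
    by rewrite expr0 mul1r; apply: mulfI; rewrite invr_eq0 pnatr_eq0.
  have prl i : exists i', pr (lshift n i) = lshift n i'.
    have := kindP (lshift n i); rewrite is_eq_lifted_ineq.
    case: (split_ordP (pr (lshift n i))) => i' ->; first by exists i'.
    by rewrite is_eq_lifted_eq.
  pose f i := projT1 (cid (prl i)).
  have fP i : pr (lshift n i) = lshift n (f i) by rewrite /f; case: cid.
  have f_inj : injective f.
    by move=> i j eij; apply: (@lshift_inj m n); apply: (@perm_inj _ pr); rewrite !fP eij.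
  exists (perm f_inj); split.
    apply/matrixP => i j; rewrite mxE mul_mx_signed permE.
    have := coefP (lshift n i) (signed_index false j).
    by rewrite fP signed_permE !coef_lifted_ineq expr0 mul1r.
  apply/colP => i; rewrite [RHS]mxE permE.
  by have := rhsP (lshift n i); rewrite fP /= !col_mxEu.
pose g := perm (@sum_perm_fun_inj m n pr sigma).
have gl i : g (lshift n i) = lshift n (pr i).
  by rewrite permE /sum_perm_fun -[lshift n i]/(unsplit (inl i)) unsplitK.
have gr i : g (rshift m i) = rshift m (sigma i).
  by rewrite permE /sum_perm_fun -[rshift m i]/(unsplit (inr i)) unsplitK.
exists g; split=> [i k|i|k|i].
- rewrite -[k]signed_indexK signed_permE.
  case: (split_ordP i) => {}i ->.
    rewrite gl !coef_lifted_ineq {1}AQ mxE mul_mx_signed.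
    by rewrite mulrA signr_addb.
  by rewrite gr !coef_lifted_eq (inj_eq perm_inj).
- case: (split_ordP i) => {}i ->; last by rewrite gr /= !col_mxEd !mxE.
  by rewrite gl /= !col_mxEu -/lifted_rhs {1}dP mxE.
- rewrite -[k]signed_indexK signed_permE !obj_lifted; congr (_ * _).
  have := congr1 (fun u : 'rV_n => u 0 (index_of k)) cQ.
  by rewrite mul_mx_signed !mxE => ->; rewrite mulrA signr_addb.
- by case: (split_ordP i) => {}i ->; rewrite ?gl ?gr ?is_eq_lifted_eq ?is_eq_lifted_ineq.
Qed.

Lemma affine_eqP p (u v : 'cV[R]_p) (M N : 'M[R]_(p, n)) :
  (forall x : 'cV[R]_n, u + M *m x = v + N *m x) <-> u = v /\ M = N.
Proof.
split=> [eq_aff|[-> ->] //].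
have euv : u = v by have := eq_aff 0; rewrite !mulmx0 !addr0.
split=> //; apply/matrixP => i j.
have := eq_aff (delta_mx j 0); rewrite euv => /addrI.
by rewrite -!colE => /colP/(_ i); rewrite !mxE.
Qed.

(** Once the translation has its only possible value, the constant terms in
    the invariance of objective and slack follow from the linear ones together
    with the invariance of [2 b - A e]. *)
Lemma linear_symmetryP (Q : 'M[R]_n) :
  linear_symmetry Q <->
  (forall x : 'cV[R]_n, c^T *m x = c^T *m (Q *m x + offset Q)) /\
  (exists2 P : 'M[R]_m, is_perm_mx P
     & forall x : 'cV[R]_n, b - A *m x = P *m (b - A *m (Q *m x + offset Q))).
Proof.
have objE : (forall x : 'cV[R]_n, c^T *m x = c^T *m (Q *m x + offset Q)) <->
            c^T = c^T *m Q.
  transitivity (0 = c^T *m offset Q /\ c^T = c^T *m Q).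
    rewrite -affine_eqP; split=> H x; have := H x.
      by rewrite add0r mulmxDr mulmxA [X in _ = X]addrC.
    by rewrite add0r mulmxDr mulmxA [X in _ = X -> _]addrC.
  split=> [[]//|cQ]; split=> //.
  by rewrite /offset -scalemxAr mulmxBr mulmxA -cQ subrr scaler0.
have slackE (P : 'M[R]_m) :
    (forall x : 'cV[R]_n, b - A *m x = P *m (b - A *m (Q *m x + offset Q))) <->
    A = P *m (A *m Q) /\ lifted_rhs = P *m lifted_rhs.
  transitivity (b = P *m (b - A *m offset Q) /\ - A = - (P *m (A *m Q))).
    rewrite -affine_eqP; split=> H x; have := H x;
      by rewrite !mulNmx mulmxDr [A *m _ + A *m _]addrC opprD addrA
                 [P *m (_ - _ - _)]mulmxBr !mulmxA.
  have slack0 : P *m lifted_rhs =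
      2 *: (P *m (b - A *m offset Q)) - P *m (A *m Q) *m ones R n.
    rewrite -mulmxA scalemxAr -mulmxBr; congr (_ *m _).
    rewrite /lifted_rhs /offset -scalemxAr scalerBr scalerA divff ?pnatr_eq0 //.
    by rewrite scale1r mulmxBr mulmxA opprB addrA addrAC addrK.
  rewrite slack0 /lifted_rhs.
  split=> [[eb /oppr_inj eA]|[eA ed]]; first by rewrite -eb -eA.
  split; last by rewrite -eA.
  move: ed; rewrite -eA => /addIr /(congr1 (fun u => 2^-1 *: u)).
  by rewrite !scalerA mulVf ?pnatr_eq0 // !scale1r.
split.
  move=> [cQ [pr [AQ dP]]]; split; first exact/objE.
  exists (perm_mx pr); first exact: perm_mx_is_perm.
  by apply/slackE; rewrite -!row_permE.
move=> [/objE cQ [P /is_perm_mxP[pr ->] /slackE]]; rewrite -!row_permE.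
by move=> [AQ dP]; split=> //; exists pr.
Qed.

Lemma complement_symmetryP (Q : 'M[R]_n) (q : 'cV[R]_n) :
  complement_symmetry A b c (Q, q) <->
  [/\ signed_perm_mx Q, linear_symmetry Q & q = offset Q].
Proof.
split=> [[sQ obj_inv slack_inv]|[sQ linQ ->]].
  have [sigma [s eQ]] := signed_perm_mxP sQ.
  rewrite {1}eQ => /binary_signed; rewrite -eQ => eq_q.
  split=> //; apply/linear_symmetryP; split; first by rewrite -eq_q.
  by rewrite -eq_q.
have [? ?] := (linear_symmetryP Q).1 linQ; split=> //.
have [sigma [s eQ]] := signed_perm_mxP sQ.
by rewrite eQ; apply/binary_signed.
Qed.

End Symmetries.

Theorem theorem1 (R : realType) (m n : nat) (A : 'M[R]_(m, n))
    (b : 'cV[R]_m) (c : 'cV[R]_n) :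
  exists F : 'S_(n + n) -> 'M[R]_n * 'cV[R]_n,
    set_bij [set pc : 'S_(n + n) | perm_symmetry (lifted A b c) pc]
            [set s : 'M[R]_n * 'cV[R]_n | complement_symmetry A b c s] F.
Proof.
exists (fun pc => (signed_mx R pc, offset (signed_mx R pc))); split.
- move=> pc /= pcP; have [sigma [s epc]] := perm_symmetry_pairs pcP.
  rewrite epc in pcP *; apply/complement_symmetryP; split=> //.
    exact: signed_mx_signed_perm.
  exact/perm_symmetry_signed.
- move=> pc pc' /set_mem/= /perm_symmetry_pairs[sigma [s ->]].
  move=> /set_mem/= /perm_symmetry_pairs[sigma' [s' ->]] [eQ _].
  exact: signed_mx_inj eQ.
- move=> [Q q] /= /complement_symmetryP[/signed_perm_mxP[sigma [s ->]] linQ ->].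
  by exists (signed_perm sigma s) => //; apply/perm_symmetry_signed.
Qed.
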